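(* There exists an absolute constant $c>0$ such that for every integer $k\ge 2$ the following holds: for all primes $p$ sufficiently large (depending on $k$) and all integers $s$ with $0\le s<c\lfloor\sqrt[k]{p}\rfloor$, there exists a set $A$ of $k$ non-zero elements of $\mathbb{Z}_p$ such that $A\cup\{0\}$ is a basis for $\mathbb{Z}_p$ of order $k\lfloor\sqrt[k]{p}\rfloor+s$.
   Context: For a subset $B$ of $\mathbb{Z}_p$ and a positive integer $h$, $hB$ is the set of all sums of exactly $h$ not necessarily distinct elements of $B$. $B$ is a basis for $\mathbb{Z}_p$ of order $h$ if $hB=\mathbb{Z}_p$ and $(h-1)B\neq\mathbb{Z}_p$. *)

(* Defs.v *)
From mathcomp Require Import all_boot all_order all_algebra.
Set Implicit Arguments. Unset Strict Implicit. Unset Printing Implicit Defensive.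
Import GRing.Theory.
Local Open Scope ring_scope.

Fixpoint sumset (T : finZmodType) (h : nat) (B : {set T}) : {set T} :=
  match h with
  | 0%N => [set 0]
  | h'.+1 => [set x + y | x in sumset h' B, y in B]
  end.

Definition is_basis_of_order (T : finZmodType) (B : {set T}) (h : nat) : Prop :=
  sumset h B = [set: T] /\ sumset h.-1 B <> [set: T].

Definition floor_root (k p : nat) : nat :=
  \max_(m < p.+1 | (m ^ k <= p)%N) m.

(* Main.v *)
(** Write N = n + 1, where n is the integer part of the k-th root of p, and take
    A = {g_0, ..., g_(k-1)} with g_0 = 1, g_i = a_i g_(i-1) - e_i and g_k = p.
    Every e_i has a representation of length less than a_i, so trading a_i copies
    of g_(i-1) for g_i never lengthens a representation mod p; this makes greedy
    representations optimal on suitable residues.  While all e_i vanish, the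
    worst residue is the one with all digits maximal, and it is the only one of
    that cost; the first nonzero e_i destroys it and lowers the maximal cost by 1.
    Later e_i do no harm as long as their sum stays below the distance from the
    new worst residue to the modulus.  Hence the order is a_1 + ... + a_k - k - 1, provided that a_1 a_2 is
    reached with no defect and the first defect is not too large.  Iterated
    ceilings of p / N^j reduce the choice of the a_i to the first three of them,
    of prescribed sum 3N + 1 + s, whose product must slightly exceed a given
    number near N^3.  Fixing a_1 < N suitably and moving a_2, a_3 apart until
    their product just fits achieves this. *)
Require Import Defs.
From mathcomp Require Import all_boot all_order all_algebra.
From mathcomp Require Import zify.
Set Implicit Arguments. Unset Strict Implicit. Unset Printing Implicit Defensive.
Import Order.TTheory GRing.Theory Num.Theory.
Local Open Scope ring_scope.

(** * Representations by a list of coins *)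

(* [rep C w x]: the integer [x] is a sum of [w] elements of [C]. *)
Inductive rep (C : seq nat) : nat -> nat -> Prop :=
| rep0 : rep C 0 0
| repS w x g : g \in C -> rep C w x -> rep C w.+1 (x + g).

Lemma repD C w x w' x' : rep C w x -> rep C w' x' -> rep C (w + w') (x + x').
Proof.
move=> Hx; elim=> [|w1 x1 g Cg _ IH]; first by rewrite !addn0.
by rewrite addnS addnA; apply: repS.
Qed.

Lemma rep_muln C w x q : rep C w x -> rep C (q * w) (q * x).
Proof.
move=> Hx; elim: q => [|q IH]; first by rewrite !mul0n; apply: rep0.
by rewrite !mulSn; apply: repD.
Qed.

Lemma rep_mem C g t : g \in C -> rep C t (t * g).
Proof. by move=> Cg; have := rep_muln t (repS Cg (rep0 C)); rewrite muln1. Qed.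

Lemma rep_sub C C' w x : {subset C <= C'} -> rep C w x -> rep C' w x.
Proof. by move=> sCC'; elim=> [|w1 x1 g /sCC' Cg _ IH]; [apply: rep0 | apply: repS]. Qed.

Lemma rep_consP g C w x : rep (g :: C) w x <->
  exists t w' x', [/\ w = t + w', x = t * g + x' & rep C w' x']%N.
Proof.
split=> [|[t [w' [x' [-> -> Hx]]]]]; last first.
  apply: repD; first by apply: rep_mem; rewrite mem_head.
  by apply: rep_sub Hx => y Cy; rewrite inE Cy orbT.
elim=> [|w1 x1 g1]; first by exists 0%N, 0%N, 0%N; split=> //; apply: rep0.
rewrite inE => /predU1P[->|Cg1] _ [t [w' [x' [-> -> Hx]]]].
  by exists t.+1, w', x'; split=> //; lia.
by exists t, w'.+1, (x' + g1)%N; split; [lia | lia | apply: repS].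
Qed.

(** * Costs modulo g *)

(* The last clause is about integers rather than residues: it says that the
   cost of [m] is at least [D] mod [g], and that exceeding [m] by [q * g] costs
   [q] more.  This surplus is what the induction on the number of coins uses. *)
Definition extremal C g D m : Prop :=
  [/\ (m < g)%N, forall x, (x < g)%N -> exists2 w, (w <= D)%N & rep C w x
    & forall w q, rep C w (m + q * g) -> (D + q <= w)%N].

(* The residue [g.-1] is the only one of cost [D]. *)
Definition full C g D : Prop :=
  extremal C g D g.-1 /\
  forall x, (x < g.-1)%N -> exists2 w, (w < D)%N & rep C w x.

(** Adding [q] representations of [e] to the part without the coin [g] gives [m] plus a multiple of
    [g], where the bound for [C] applies. As [we < A], each of the [q] wraps leaves a surplus of at
    least 1. *)
Lemma extremal_cons_lower C g D m A e we B :
  (m < g)%N -> (forall w q, rep C w (m + q * g) -> (D + q <= w)%N) ->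
  rep C we e -> (we < A)%N -> (e <= A * g)%N ->
  forall w q, rep (g :: C) w (B * g + m + q * (A * g - e)) -> (D + B + q <= w)%N.
Proof.
move=> mg low re weA eAg w q /rep_consP[t [w' [x' [-> xE rx]]]].
have := repD rx (rep_muln q re) => rxq.
have xqE : (t * g + (x' + q * e) = m + (B + q * A) * g)%N.
  have : (q * (A * g - e) + q * e = q * A * g)%N by rewrite -mulnDr subnK // mulnA.
  by lia.
have tle : (t <= B + q * A)%N.
  rewrite leqNgt; apply/negP => lt.
  have : ((B + q * A).+1 * g <= t * g)%N by rewrite leq_mul2r lt orbT.
  by rewrite mulSn; lia.
have xqE' : (x' + q * e = m + (B + q * A - t) * g)%N.
  by rewrite mulnBl; have := leq_mul tle (leqnn g); lia.
rewrite xqE' in rxq; have := low _ _ rxq.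
have : (q * we + q <= q * A)%N by rewrite -mulnSr leq_mul2l weA orbT.
lia.
Qed.

Lemma extremal_step C g D m A e we :
  extremal C g D m -> rep C we e -> (we < A)%N -> (e + m < g)%N ->
  extremal (g :: C) (A * g - e) (D + A.-1) (A.-1 * g + m).
Proof.
move=> [mg up low] re weA emg; case: A weA => // A weA /=.
split; first by rewrite mulSn; lia.
- move=> x xlt; have g0 : (0 < g)%N by lia.
  have [w wD rw] := up (x %% g)%N (ltn_pmod x g0).
  exists (x %/ g + w)%N.
    have : (x %/ g < A.+1)%N by rewrite ltn_divLR //; lia.
    by lia.
  by apply/rep_consP; exists (x %/ g)%N, w, (x %% g)%N; split=> //; rewrite -divn_eq.
- by apply: extremal_cons_lower re weA _ => //; rewrite mulSn; lia.
Qed.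

Lemma full_nil : full [::] 1 0.
Proof.
have rnil w x : rep [::] w x -> w = 0%N /\ x = 0%N by case.
split=> //; split=> // [x|w q /rnil[-> E]]; last by lia.
by case: x => // _; exists 0%N => //; apply: rep0.
Qed.

Lemma full_step C g D A : (0 < g)%N -> (0 < A)%N ->
  full C g D -> full (g :: C) (A * g) (D + A.-1).
Proof.
move=> g0 A0 [ext lt].
have gE : (A.-1 * g + g.-1 = (A * g).-1)%N by case: A A0 => //= A _; rewrite mulSn; lia.
split.
  have := extremal_step ext (rep0 C) A0.
  by rewrite subn0 gE; apply; lia.
move=> x xlt; have [_ up _] := ext.
have qA : (x %/ g < A)%N by rewrite ltn_divLR //; lia.
(* A maximal remainder excludes the maximal quotient, because [x < (A * g).-1]. *)
have [/eqP xg|xg] := boolP (x %% g == g.-1)%N; last first.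
  have := ltn_pmod x g0 => xlt'.
  have [|w wD rw] := lt (x %% g)%N; first by lia.
  exists (x %/ g + w)%N; first by lia.
  by apply/rep_consP; exists (x %/ g)%N, w, (x %% g)%N; split=> //; rewrite -divn_eq.
have [w wD rw] := up (x %% g)%N (ltn_pmod x g0).
exists (x %/ g + w)%N.
  suff : (x %/ g != A.-1)%N by lia.
  apply/eqP=> xE; have := divn_eq x g; rewrite xE xg; lia.
by apply/rep_consP; exists (x %/ g)%N, w, (x %% g)%N; split=> //; rewrite -divn_eq.
Qed.

(* The old worst residue [g.-1] is no longer available below the top digit
   [A.-1], hence [A.-2] in place of [A.-1]. *)
Lemma defect_step C g D A e we : full C g D -> rep C we e ->
  (0 < e <= g)%N -> (we < A)%N -> (1 < A)%N ->
  extremal (g :: C) (A * g - e) (D + A.-2) (A.-1 * g).-1.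
Proof.
move=> [[mg up low] lt] re /andP[e0 eg] weA; case: A weA => [//|[//|A]] weA _ /=.
have mE : ((A.+1 * g).-1 = A * g + g.-1)%N by rewrite mulSn; lia.
rewrite mE; have g0 : (0 < g)%N by lia.
split; first by rewrite !mulSn; lia.
- move=> x xlt.
  have xE := divn_eq x g; have xr := ltn_pmod x g0.
  have qA : (x %/ g < A.+2)%N by rewrite ltn_divLR //; lia.
  have [qA'|qA'] := leqP (x %/ g)%N A.
    have [w wD rw] := up _ xr.
    exists (x %/ g + w)%N; first by lia.
    by apply/rep_consP; exists (x %/ g)%N, w, (x %% g)%N.
  (* Since [0 < e], the top quotient forces a remainder below [g.-1], where fullness saves 1. *)
  have qE : (x %/ g = A.+1)%N by lia.
  rewrite qE in xE; have [|w wD rw] := lt (x %% g)%N.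
    by move: xlt xE; rewrite !mulSn; lia.
  exists (A.+1 + w)%N; first by lia.
  by apply/rep_consP; exists A.+1, w, (x %% g)%N.
- by apply: extremal_cons_lower re weA _ => //; rewrite !mulSn; lia.
Qed.

(** * Iterated ceilings *)

Definition ceil_div N x := ((x + N.-1) %/ N)%N.

Lemma ceil_divP N x : (0 < N)%N ->
  exists2 e, (e < N)%N & (x + e = N * ceil_div N x)%N.
Proof.
move=> N0; exists (N.-1 - (x + N.-1) %% N)%N; first by lia.
rewrite /ceil_div; have := divn_eq (x + N.-1) N; have := ltn_pmod (x + N.-1) N0.
rewrite (mulnC N); lia.
Qed.

(** Uniqueness and the range make the coins distinct non-zero residues; the coin 1 represents any
    defect [e] at cost [e]. *)
Definition valid C g : bool :=
  [&& uniq C, 1%N \in C & all (fun x => 0 < x < g)%N C].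

Lemma valid_cons C g g' : (0 < g < g')%N -> valid C g -> valid (g :: C) g'.
Proof.
move=> gg' /and3P[uC C1 /allP Cg]; apply/and3P; split.
- by rewrite /= uC andbT; apply/negP => /Cg; rewrite ltnn andbF.
- by rewrite inE C1 orbT.
- by rewrite /= gg' /=; apply/allP => x /Cg; lia.
Qed.

Lemma extremal_iter N j : (1 < N)%N -> forall C p D m,
  extremal C (iter j (ceil_div N) p) D m -> valid C (iter j (ceil_div N) p) ->
  (m + j * N < iter j (ceil_div N) p)%N ->
  exists C' m', [/\ extremal C' p (D + j * N.-1) m', valid C' p
    & size C' = size C + j]%N.
Proof.
move=> N1 C p D m.
(* A step shrinks the distance from the worst residue to the modulus by its defect, less than [N];
   [i * N] is kept in reserve for later steps. *)
suff: extremal C (iter j (ceil_div N) p) D m -> valid C (iter j (ceil_div N) p) ->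
  forall i, (m + (i + j) * N < iter j (ceil_div N) p)%N ->
  exists C' m', [/\ extremal C' p (D + j * N.-1) m', valid C' p,
     m' + i * N < p & size C' = size C + j]%N.
  move=> H ext vC gap; have [C' [m' [? ? _ ?]]] := H ext vC 0%N gap.
  by exists C', m'.
elim: j p => [|j IH] p; rewrite ?iterSr.
  move=> ext vC i gap; exists C, m; rewrite !addn0 in gap *.
  by split.
move=> ext vC i gap; have [|C' [m' [ext' vC' gap' sz]]] := IH _ ext vC i.+1.
  by move: gap; rewrite addnS addSn.
have N0 : (0 < N)%N by lia.
have [e eN pE] := ceil_divP p N0.
set g := ceil_div N p in ext' vC' gap' pE.
have C1 : 1%N \in C' by case/and3P: vC'.
have re : rep C' e e by have := rep_mem e C1; rewrite muln1.
have peq : (N * g - e = p)%N by lia.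
have eg : (e + m' < g)%N by move: gap'; rewrite mulSn; lia.
have gN : (N * g = N.-1 * g + g)%N by rewrite -{1}(prednK N0) mulSn addnC.
have N1g : (g <= N.-1 * g)%N by apply: leq_pmull; lia.
exists (g :: C'), (N.-1 * g + m')%N; split.
- have := extremal_step ext' re eN eg.
  by rewrite peq mulSnr addnA.
- by apply: valid_cons vC'; lia.
- by move: gap'; rewrite mulSn; lia.
- by rewrite /= sz; lia.
Qed.

Lemma iter_ceil_div_ge N j p : (0 < N)%N -> (p <= N ^ j * iter j (ceil_div N) p)%N.
Proof.
move=> N0; elim: j p => [|j IH] p; first by rewrite mul1n.
rewrite iterSr; have [e _ pE] := ceil_divP p N0.
have := IH (ceil_div N p); rewrite -(leq_pmul2l N0) mulnA -expnS; lia.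
Qed.

Lemma iter_ceil_div_le N j q p : (0 < N)%N -> (p <= N ^ j * q)%N ->
  (iter j (ceil_div N) p <= q)%N.
Proof.
move=> N0; elim: j p => [|j IH] p; first by rewrite mul1n.
rewrite iterSr => ple; apply: IH; have [e eN pE] := ceil_divP p N0.
rewrite expnS -mulnA in ple.
rewrite -ltnS -(ltn_pmul2l N0) mulnS; lia.
Qed.

(** * From costs to sumsets *)

Lemma sumset_add (T : finZmodType) (B : {set T}) h h' x y :
  x \in sumset h B -> y \in sumset h' B -> x + y \in sumset (h + h') B.
Proof.
move=> Bx; elim: h' y => [|h' IH] y /=.
  by rewrite inE addn0 => /eqP->; rewrite addr0.
case/imset2P=> y1 y2 By1 By2 ->; rewrite addnS addrA /=.
by apply/imset2P; exists (x + y1) y2 => //; apply: IH.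
Qed.

(** The element 0 pads shorter sums, so exactly [h] summands become at most [h]. *)
Lemma sumset0_rep (T : finNzRingType) (C : seq nat) h (z : T) :
  z \in sumset h (0 |: [set:: [seq x%:R | x <- C]]) <->
  exists w x, [/\ (w <= h)%N, rep C w x & z = x%:R].
Proof.
split=> [|[w [x [wh rx ->]]]].
  elim: h z => [|h IH] z /=.
    by rewrite inE => /eqP->; exists 0%N, 0%N; split=> //; apply: rep0.
  case/imset2P=> y b /IH[w [x [wh rx ->]]] Bb ->; case/setU1P: Bb => [->|].
    by exists w, x; split=> //; [apply: leqW | rewrite addr0].
  rewrite inE => /mapP[g Cg ->]; exists w.+1, (x + g)%N.
  by split; [lia | apply: repS | rewrite natrD].
set B := 0 |: _; have rB : x%:R \in sumset w B.
  elim: rx => [|w1 x1 g Cg _ IH]; first by rewrite inE.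
  apply/imset2P; exists x1%:R g%:R => //; last by rewrite natrD.
  by apply/setU1P; right; rewrite inE; apply/mapP; exists g.
have : 0 \in sumset (h - w) B.
  elim: (h - w)%N => [|d IH]; first by rewrite inE.
  by apply/imset2P; exists 0 0 => //; [apply: setU11 | rewrite addr0].
by move=> /(sumset_add rB); rewrite addr0 subnKC.
Qed.

Lemma basis_of_extremal p C D m : prime p -> (0 < D)%N -> valid C p ->
  extremal C p D m ->
  exists A : {set 'Z_p},
    #|A| = size C /\ (0 \notin A) /\ is_basis_of_order (0 |: A) D.
Proof.
move=> pp D0 /and3P[uC _ /allP Cp] [mp up low]; have p1 := prime_gt1 pp.
have natZ x : (x < p)%N -> (x%:R : 'Z_p) = x :> nat.
  by move=> xp; rewrite val_Zp_nat // modn_small.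
exists [set:: [seq x%:R | x <- C]]; split; last split; last split.
- rewrite cardsE -(size_map (fun x => x%:R : 'Z_p)); apply/card_uniqP.
  rewrite map_inj_in_uniq // => x y Cx Cy /(congr1 (@nat_of_ord _)).
  by rewrite !natZ //; [case/andP: (Cp _ Cy) | case/andP: (Cp _ Cx)].
- rewrite inE; apply/mapP => -[x /Cp/andP[x0 xp]] /(congr1 (@nat_of_ord _)).
  by rewrite natZ //= => E; rewrite -E in x0.
- apply/setP => z; rewrite inE; apply/sumset0_rep.
  have zp : (z < p)%N by have := ltn_ord z; rewrite [X in (_ < X)%N]Zp_cast.
  by have [w wD rw] := up _ zp; exists w, (z : nat); split; rewrite // natr_Zp.
- move/setP/(_ m%:R); rewrite [RHS]inE => /sumset0_rep[w [x [wD rx E]]].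
  have xm : (x %% p = m)%N.
    by move/(congr1 (@nat_of_ord _)): E; rewrite natZ // val_Zp_nat.
  rewrite (divn_eq x p) xm addnC in rx.
  have := leq_trans (leq_trans (leq_addr _ _) (low _ _ rx)) wD.
  by rewrite -ltnS prednK // ltnn.
Qed.

(** * Choice of the radices *)

(* Take [b] least: moving [b] and [c] apart by one step lowers [b * c] by
   [c - b + 1]. *)
Lemma exists_product_near L H a : (a * (L - a) <= H <= L./2 * (L - L./2))%N ->
  (a <= L./2)%N ->
  exists b c, [/\ b + c = L, a <= b <= c & H <= b * c <= H + (c - b)]%N.
Proof.
move=> /andP[aH HL] aL.
pose P b := ((a <= b) && (H <= b * (L - b)))%N.
have exP : exists b, P b by exists L./2; apply/andP.
have Lhalf : (L./2 + L./2 <= L)%N by lia.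
case: (ex_minnP exP) => b /andP[ab Hb] bmin.
have bL : (b <= L./2)%N by apply: bmin; apply/andP.
exists b, (L - b)%N; split; [lia|lia|].
(* At the lower end [b = a] the hypothesis itself gives [b * c <= H]. *)
rewrite Hb /=; have [E|ne] := eqVneq a b; first by subst b; lia.
have [c Ec] : exists c, L = (b + c)%N by exists (L - b)%N; lia.
subst L; rewrite addKn in Hb *.
have : ~~ P b.-1 by apply/negP => /bmin; lia.
rewrite /P (_ : a <= b.-1)%N /=; last by lia.
rewrite -ltnNge (_ : b + c - b.-1 = c.+1)%N; last by lia.
have -> : (b * c = b.-1 * c + c)%N by rewrite -{1}(prednK (n := b)) ?mulSnr //; lia.
rewrite mulnS; lia.
Qed.

(** With [N = n + 1], this sum makes [(a - 1) + (b - 2)] equal to [2 * n + s]. *)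
Lemma two_factors N p s : (100 <= N)%N -> (100 * s < N)%N ->
  (N.-1 ^ 2 <= p < N ^ 2)%N ->
  exists a b, [/\ a + b = 2 * N + 1 + s, 1 < a <= b & 0 < a * b - p <= a /\ a * b - p < b]%N.
Proof.
move=> N100 sN /andP[pge plt].
(* Near [4N/5] the product is still below [p], while [c < 2 * b] keeps the defect, at most
   [c - b + 1], within [b]. *)
have [x xE] : exists x, (x * 5 <= N * 4 < x * 5 + 5)%N by exists (N * 4 %/ 5)%N; lia.
have [||b [c [bcE /andP[xb bc] /andP[ge le]]]] := @exists_product_near (2 * N + 1 + s) p.+1 x.
- apply/andP; split.
    have [y yE] : exists y, (2 * N + 1 + s = x + y)%N by exists (2 * N + 1 + s - x)%N; lia.
    rewrite yE addKn; nia.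
  nia.
- lia.
exists b, c; split => //; first by lia.
lia.
Qed.

(* The other two factors have sum [2 * a + D]: taken as [a] and [a + D] they give
   a product at most [G], and by [cube_gap] they exceed [G] when nearly equal. *)
Lemma exists_first_factor K N G s : (100 * K + 1000 <= N)%N ->
  (100 * s < N)%N -> (G <= N ^ 3 <= G + K * N ^ 2)%N ->
  exists2 a, (9 * N < 10 * a + 10)%N &
    exists2 D, (3 * a + D = 3 * N + 1 + s)%N /\ (10 <= D)%N &
      (a * a * (a + D) <= G < a.+1 * a.+1 * (a + D - 2))%N.
Proof.
move=> Nlarge sN /andP[GN NG].
pose Q a := ((a <= N) && (a * a * (3 * N + 1 + s - 2 * a) <= G))%N.
have [x xN] : exists x, (10 * x <= 9 * N < 10 * x + 10)%N by exists (9 * N %/ 10)%N; lia.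
have Qx : Q x.
  apply/andP; split; first by lia.
  have E3 : (N ^ 3 = N * (N * N))%N by [].
  have E2 : (N ^ 2 = N * N)%N by [].
  rewrite E3 E2 in GN NG.
  (* The product is at most [0.81 * 1.214 * N ^ 3], and [K * N ^ 2 <= N ^ 3 / 100]. *)
  suff : (100 * 1000 * (x * x * (3 * N + 1 + s - 2 * x)) +
    100 * 1000 * (K * (N * N)) <= 100 * 1000 * (N * (N * N)))%N by lia.
  have le1 : (100 * (x * x) <= 81 * (N * N))%N by nia.
  have le2 : (1000 * (3 * N + 1 + s - 2 * x) <= 1214 * N)%N by lia.
  have := leq_mul le1 le2.
  have : (100 * (K * (N * N)) + 1000 * (N * N) <= N * (N * N))%N.
    by rewrite mulnA -mulnDl leq_mul2r Nlarge orbT.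
  lia.
have exQ : exists a, Q a by exists x.
have Qle a : Q a -> (a <= N)%N by case/andP.
case: (ex_maxnP exQ Qle) => a /andP[aN aG] amax.
have xa := amax _ Qx.
exists a; first by lia.
have [D DE] : exists D, (3 * a + D = 3 * N + 1 + s)%N by exists (3 * N + 1 + s - 3 * a)%N; lia.
have SE : (3 * N + 1 + s - 2 * a = a + D)%N by lia.
rewrite SE in aG.
(* Otherwise [a >= N - 2], and such nearly equal factors with sum above [3 * N] have product above
   [N ^ 3]. *)
have D10 : (10 <= D)%N.
  rewrite leqNgt; apply/negP => D9.
  suff : (N ^ 3 < a * a * (a + D))%N by lia.
  have [i [iN i2]] : exists i, (N = a + i /\ i <= 2)%N by exists (N - a)%N; lia.
  subst N; have -> : (D = 1 + s + 3 * i)%N by lia.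
  clear - Nlarge i2; have a900 : (900 <= a)%N by lia.
  rewrite !expnS expn0 muln1; move: i i2 {Nlarge} => [|[|[|//]]] _; nia.
exists D => //; rewrite aG /=.
have aN' : (a < N)%N.
  rewrite ltn_neqAle aN andbT; apply/eqP => aE; subst a.
  have : (N ^ 3 < N * N * (N + D))%N by rewrite !expnS expn0; nia.
  lia.
have : ~~ Q a.+1 by apply/negP => /amax; rewrite ltnn.
rewrite /Q aN' /= -ltnNge.
by have -> : (3 * N + 1 + s - 2 * a.+1 = a + D - 2)%N by lia.
Qed.

(** Both sides agree in the two leading powers of [a]. For [D = 2 * d] the difference is
    [(d - 1) * ((d - 3) * a - 2)], non-negative once [d >= 5]; odd [D] is similar. *)
Lemma cube_gap a D : (0 < a)%N -> (10 <= D)%N ->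
  (a.+1 * a.+1 * (a + D - 2) <= (2 * a + D)./2 * (2 * a + D - (2 * a + D)./2) * a)%N.
Proof.
move=> a0 D10.
have [d [d5 [->|->]]] : exists d, (5 <= d)%N /\ (D = 2 * d \/ D = (2 * d).+1).
- exists D./2; lia.
- have -> : ((2 * a + 2 * d)./2 = a + d)%N by lia.
  have -> : (2 * a + 2 * d - (a + d) = a + d)%N by lia.
  have [e ->] : exists e, d = e.+4.+1 by exists (d - 5)%N; lia.
  have -> : (a + 2 * e.+4.+1 - 2 = a + 2 * e + 8)%N by lia.
  have [f ->] : exists f, a = f.+1 by exists a.-1; lia.
  nia.
- have -> : ((2 * a + (2 * d).+1)./2 = a + d)%N by lia.
  have -> : (2 * a + (2 * d).+1 - (a + d) = a + d.+1)%N by lia.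
  have [e ->] : exists e, d = e.+4.+1 by exists (d - 5)%N; lia.
  have -> : (a + (2 * e.+4.+1).+1 - 2 = a + 2 * e + 9)%N by lia.
  have [f ->] : exists f, a = f.+1 by exists a.-1; lia.
  nia.
Qed.

(** The defect consists of [v] coins [a] and [u] coins 1, hence costs only [u + v]. The last clause
    is the room consumed by the iterated ceilings. *)
Lemma three_factors K N G s : (100 * K + 1000 <= N)%N ->
  (100 * s < N)%N -> (G <= N ^ 3 <= G + K * N ^ 2)%N ->
  exists a b c u v, [/\ a + b + c = 3 * N + 1 + s, 1 < a /\ a <= b <= c,
    G + (v * a + u) = c * (b * a), 0 < v * a + u /\ u + v < c
    & v * a + u + K * N < b * a]%N.
Proof.
move=> Nlarge sN GN.
have [a aN [D [DE D10] /andP[Gge Glt]]] := exists_first_factor Nlarge sN GN.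
have a0 : (0 < a)%N by lia.
(* [(G %/ a).+1] is the least value of [b * c] for which the defect is positive. *)
have [||b [c [bcE /andP[ab bc] /andP[ge le]]]] :=
  @exists_product_near (2 * a + D) (G %/ a).+1 a.
- apply/andP; split.
    rewrite (_ : 2 * a + D - a = a + D)%N; last by lia.
    by apply: leqW; rewrite leq_divRL // mulnAC.
  by rewrite ltn_divLR //; apply: leq_trans Glt (cube_gap a0 D10).
- lia.
have [t tE] : exists t, (b * c = (G %/ a).+1 + t)%N by exists (b * c - (G %/ a).+1)%N; lia.
have tle : (t <= c - b)%N by lia.
have GE := divn_eq G a; have ra := ltn_pmod G a0.
have prodE : (c * (b * a) = (G %/ a) * a + a + t * a)%N.
  by rewrite mulnA (mulnC c) tE mulnDl mulSnr.
have gap : ((t + 1) * a + K * N < b * a)%N.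
  have KN : (K * N <= K * 2 * a)%N by rewrite -mulnA leq_mul2l; lia.
  have tb : (t + 1 + K * 2 < b)%N by lia.
  by apply: leq_ltn_trans (leq_add (leqnn _) KN) _; rewrite -mulnDl ltn_pmul2r.
(* The defect is [(t + 1) * a - G %% a]. *)
have [r0|r0] := posnP (G %% a)%N.
  by exists a, b, c, 0%N, t.+1; split; rewrite ?addn0; lia.
by exists a, b, c, (a - G %% a)%N, t; split; lia.
Qed.

(** * Integer roots and assembly of the proof *)

Lemma floor_rootP k p : (0 < k)%N ->
  (floor_root k p ^ k <= p < (floor_root k p).+1 ^ k)%N.
Proof.
move=> k0; apply/andP; split.
  rewrite /floor_root; elim/big_ind: _ => //; first by rewrite exp0n.
  by move=> x y; rewrite /maxn; case: ifP.
rewrite ltnNge; apply/negP => le.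
have np : ((floor_root k p).+1 < p.+1)%N.
  by rewrite ltnS (leq_trans _ le) // -{1}[_.+1]expn1 leq_pexp2l.
have := @leq_bigmax_cond _ (fun m : 'I_p.+1 => (m ^ k <= p)%N)
  (fun m : 'I_p.+1 => m : nat) (Ordinal np) le.
by rewrite /= -/(floor_root k p) ltnn.
Qed.

(** A discrete mean value estimate; divided by [N ^ j], it puts [G] within [j.+3 * N ^ 2] of
    [N ^ 3]. *)
Lemma leq_expn_pred N k : (0 < N)%N -> (N ^ k.+1 <= N.-1 ^ k.+1 + k.+1 * N ^ k)%N.
Proof.
move=> N0; elim: k => [|k IH]; first by rewrite !expn1; lia.
rewrite expnS -[X in (X * _)%N](prednK N0) mulSn.
have le1 : (N.-1 * N ^ k.+1 <= N.-1 * (N.-1 ^ k.+1 + k.+1 * N ^ k))%N.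
  by rewrite leq_mul2l IH orbT.
have le2 : (N.-1 * (k.+1 * N ^ k) <= k.+1 * N ^ k.+1)%N.
  by rewrite mulnCA leq_mul2l expnS leq_mul2r leq_pred !orbT.
rewrite (expnS N.-1 k.+1) (mulSn k.+1); move: le1; rewrite mulnDr; lia.
Qed.

Lemma valid1 g : (1 < g)%N -> valid [:: 1%N] g.
Proof. by move=> g1; rewrite /valid /= g1. Qed.

Lemma exists_extremal_two n p s : (99 <= n)%N -> (100 * s <= n)%N ->
  (n ^ 2 <= p < n.+1 ^ 2)%N ->
  exists C m, [/\ extremal C p (2 * n + s) m, valid C p & size C = 2%N].
Proof.
move=> n99 sn np.
have [||a [b [abE /andP[a1 ab] [/andP[e0 ea] eb]]]] := @two_factors n.+1 p s _ _ np; try lia.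
have full1 : full [:: 1%N] a a.-1.
  by have := full_step _ _ full_nil; move=> /(_ a); rewrite muln1; apply; lia.
have re : rep [:: 1%N] (a * b - p) (a * b - p).
  by have := rep_mem (a * b - p) (mem_head 1%N [::]); rewrite muln1.
have pE : (b * a - (a * b - p) = p)%N by rewrite (mulnC b) subKn //; lia.
have ext := defect_step full1 re _ eb; rewrite pE in ext.
exists [:: a; 1%N], (b.-1 * a).-1; split => //.
  have -> : (2 * n + s = a.-1 + b.-2)%N by lia.
  by apply: ext; lia.
apply: valid_cons (valid1 a1); apply/andP; split; first by lia.
have : (2 * a <= b * a)%N by rewrite leq_mul2r; lia.
nia.
Qed.

Lemma exists_extremal_ge3 j n p s : (100 * j.+3 + 1000 <= n)%N ->
  (100 * s <= n)%N -> (n ^ j.+3 <= p < n.+1 ^ j.+3)%N ->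
  exists C m, [/\ extremal C p (j.+3 * n + s) m, valid C p & size C = j.+3].
Proof.
move=> nlarge sn /andP[np pn]; set N := n.+1.
pose G := iter j (ceil_div N) p.
have GN : (G <= N ^ 3 <= G + j.+3 * N ^ 2)%N.
  apply/andP; split.
    by apply: iter_ceil_div_le => //; rewrite -expnD addn3 ltnW.
  have Nj0 : (0 < N ^ j)%N by rewrite expn_gt0.
  rewrite -(leq_pmul2l Nj0) mulnDr mulnCA -!expnD addn3 addn2.
  apply: leq_trans (leq_expn_pred _ _) _ => //.
  by rewrite leq_add2r (leq_trans np) // iter_ceil_div_ge.
have [||a [b [c [u [v [abcE [a1 /andP[ab bc]] GE [e0 uvc] gap]]]]]] :=
  @three_factors j.+3 N G s _ _ GN; try (rewrite /N; lia).
have full2 : full [:: a; 1%N] (b * a) (a.-1 + b.-1).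
  have := full_step _ _ (full_step _ _ full_nil).
  by move=> /(_ a b); rewrite muln1 add0n; apply; lia.
have re : rep [:: a; 1%N] (v + u) (v * a + u).
  apply: repD; first by apply: rep_mem; rewrite mem_head.
  by have := @rep_mem [:: a; 1%N] 1 u; rewrite muln1; apply; rewrite !inE orbT.
have ext := @defect_step _ _ _ c _ _ full2 re _ _ _.
have GE' : (c * (b * a) - (v * a + u) = G)%N by lia.
rewrite GE' in ext.
have cE : (c * (b * a) = c.-1 * (b * a) + b * a)%N.
  by rewrite -mulSnr prednK //; lia.
have c1 : (2 * (b * a) <= c.-1 * (b * a))%N by rewrite leq_mul2r; lia.
have b1 : (2 * a <= b * a)%N by rewrite leq_mul2r; lia.
have jN : (j * N <= j.+3 * N)%N by rewrite leq_mul2r; lia.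
have [||||C [m [extC vC szC]]] := @extremal_iter N j _ [:: (b * a)%N; a; 1%N] p
  (a.-1 + b.-1 + c.-2) (c.-1 * (b * a)).-1; rewrite -/G.
- by rewrite /N; lia.
- by apply: ext; lia.
- apply: valid_cons; first by lia.
  by apply: valid_cons (valid1 a1); lia.
- by lia.
exists C, m; rewrite szC; split=> //.
suff -> : (j.+3 * n + s = a.-1 + b.-1 + c.-2 + j * N.-1)%N by [].
by rewrite /N /= !mulSn; move: abcE; rewrite /N; lia.
Qed.

Theorem theorem4p4 :
  exists c : rat, 0 < c /\
    forall k : nat, (2 <= k)%N ->
      exists P : nat, forall p : nat, prime p -> (P <= p)%N ->
        forall s : nat, (s%:R < c * (floor_root k p)%:R :> rat) ->
          exists A : {set 'Z_p},
            #|A| = k /\ (0 \notin A) /\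
            is_basis_of_order (0 |: A) (k * floor_root k p + s)%N.
Proof.
exists (100%:R^-1); split; first by rewrite invr_gt0 ltr0n.
(* This threshold forces [n >= 100 * k + 1000], as the choice of three factors demands. *)
move=> k k2; exists ((100 * k + 1000) ^ k)%N => p pp Pp s.
rewrite mulrC ltr_pdivlMr ?ltr0n // -natrM ltr_nat mulnC => sn.
have k0 : (0 < k)%N by lia.
have /andP[np pn] := floor_rootP p k0.
set n := floor_root k p in sn np pn *.
have nlarge : (100 * k + 1000 <= n)%N.
  by rewrite -ltnS -(ltn_exp2r _ _ k0); apply: leq_ltn_trans pn.
suff [C [m [ext vC szC]]] : exists C m,
    [/\ extremal C p (k * n + s) m, valid C p & size C = k].
  rewrite -szC in ext *; apply: basis_of_extremal vC ext => //.
  by rewrite szC addn_gt0 muln_gt0 k0; lia.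
case: k k2 {k0 Pp} @n sn np pn nlarge => [|[|[|j]]] // _ n sn np pn nlarge.
  by apply: exists_extremal_two; rewrite ?np //; lia.
by apply: exists_extremal_ge3; rewrite ?np //; lia.
Qed.
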